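(* Let $a>b$ be relatively prime positive integers and let $\omega(a,b)=\underbrace{RR\cdots R}_{a}\underbrace{UU\cdots U}_{b}$. Then $\omega(a,b)\in\mathcal{D}(a,b)$, and it is the unique maximal element of $\mathcal{D}(a,b)$ with respect to both orderings $<_M$ and $<_L$; that is, for every $\omega\in\mathcal{D}(a,b)$ with $\omega\neq\omega(a,b)$ we have $M(\omega)<M(\omega(a,b))$ and $L(\omega)<L(\omega(a,b))$.
   Context: A lattice path from $(0,0)$ to $(a,b)$ is a word $w_1w_2\cdots w_{a+b}$ in the letters $R$ (unit step right) and $U$ (unit step up) containing $a$ letters $R$ and $b$ letters $U$. $\mathcal{D}(a,b)$ denotes the set of such paths lying (weakly) below the diagonal line $y=\frac{b}{a}x$. For a word $W=w_1\cdots w_n$ in $R,U$, let $f(W)=[a_0,a_1,\ldots,a_t]$ be the finite continued fraction whose entry sequence is obtained by scanning $i=1,\ldots,n-1$ in order and appending $1,1$ if $w_i=w_{i+1}$ and appending $2$ if $w_i\neq w_{i+1}$. The numerator of a finite continued fraction $[c_0,\ldots,c_t]$ is $p_t$, where $p_{-2}=0$, $p_{-1}=1$, $p_i=c_ip_{i-1}+p_{i-2}$. Define $M(\omega)$ to be the numerator of $f(\omega)$ (equivalently, by Çanakçı–Schiffler, the number of perfect matchings of the snake graph of $\omega$). Let $g(\omega)=[\overline{2,a_0,a_1,\ldots,a_t}]$ be the infinite purely periodic continued fraction with period $(2,a_0,\ldots,a_t)$, where $f(\omega)=[a_0,\ldots,a_t]$. For an irrational $\alpha$, its Lagrange number is $L(\alpha)=\sup\{L:\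 |\frac{p}{q}-\alpha|<\frac{1}{Lq^2}\text{ for infinitely many reduced fractions }\frac pq\}$, and $L(\omega):=L(g(\omega))$. The orderings are: $\omega<_M\omega'$ iff $M(\omega)<M(\omega')$, and $\omega<_L\omega'$ iff $L(\omega)<L(\omega')$. *)

(* Defs.v *)
From HB Require Import structures.
From mathcomp Require Import all_boot all_order all_algebra.
From mathcomp Require Import all_classical all_reals all_analysis.
Import Order.TTheory GRing.Theory Num.Theory numFieldNormedType.Exports.

Set Implicit Arguments.
Unset Strict Implicit.
Unset Printing Implicit Defensive.

Local Open Scope classical_set_scope.
Local Open Scope ring_scope.

Inductive step := Right | Up.

Definition bool_of_step (s : step) : bool := if s is Right then true else false.
Definition step_of_bool (b : bool) : step := if b then Right else Up.

Lemma bool_of_stepK : cancel bool_of_step step_of_bool.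
Proof. by case. Qed.

HB.instance Definition _ := Countable.copy step (can_type bool_of_stepK).

Definition word := seq step.

(* The half-plane y <= (b/a) x is convex, so a path lies in it as soon as all
   its vertices, i.e. the endpoints of its prefixes, do. *)
Definition paths_below_diagonal (a b : nat) : set word :=
  [set w | [/\ count_mem Right w = a, count_mem Up w = b &
     forall k : nat, (a * count_mem Up (take k w)
                       <= b * count_mem Right (take k w))%N]].

Definition corner_path (a b : nat) : word := nseq a Right ++ nseq b Up.

Definition cf_entries (w : word) : seq nat :=
  if w is x :: w' then
    flatten (pairmap (fun u v => if u == v then [:: 1; 1] else [:: 2])%N x w')
  else [::].

(* The state is (p_(i-1), p_(i-2)). Numerators start from
   (p_(-1), p_(-2)) = (1, 0) and denominators from (q_(-1), q_(-2)) = (0, 1). *)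
Definition cf_next (s : nat * nat) (c : nat) : nat * nat :=
  (c * s.1 + s.2, s.1)%N.
Definition cf_num (c : seq nat) : nat := (foldl cf_next (1, 0)%N c).1.
Definition cf_den (c : seq nat) : nat := (foldl cf_next (0, 1)%N c).1.

Definition path_num (w : word) : nat := cf_num (cf_entries w).

(* Value of [c 0, c 1, c 2, ...] as the limit of its convergents; the limit
   exists whenever all the entries are positive. *)
Definition cf_value (R : realType) (c : nat -> nat) : R :=
  limn (fun n : nat =>
    (cf_num (mkseq c n.+1))%:R / (cf_den (mkseq c n.+1))%:R : R).

Definition periodic_cf_value (R : realType) (s : seq nat) : R :=
  cf_value R (fun n => nth 0%N s (n %% size s)%N).

Definition path_irrational (R : realType) (w : word) : R :=
  periodic_cf_value R (2%N :: cf_entries w).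

(* Elements of rat are the reduced fractions p/q, with q = denq > 0. The
   supremum is taken in the extended reals because it can be infinite. *)
Definition lagrange_number (R : realType) (alpha : R) : \bar R :=
  ereal_sup [set l%:E | l in [set l : R | 0 < l /\
    infinite_set [set x : rat |
      `|ratr x - alpha| < 1 / (l * (denq x)%:~R ^+ 2)]]].

Definition path_lagrange (R : realType) (w : word) : \bar R :=
  lagrange_number (path_irrational R w).

(* Main.v *)
Require Import Defs.
From mathcomp Require Import all_boot all_order all_algebra.
From mathcomp Require Import all_classical all_reals all_analysis.
From mathcomp Require Import zify ring lra.
Import Order.TTheory GRing.Theory Num.Theory numFieldNormedType.Exports.

(* A word in D(a,b) starts with RR and ends with U.

   For [M]: put A = [[2,1],[1,1]] and B = [[1,1],[1,2]]. If w starts with R and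
   ends with U, then M(w) is the lower left entry of the product of the letters
   of w under R |-> A, U |-> B. The commutator of A^i and B^j is a positive
   multiple of [[0,2],[-2,0]], so rewriting R^i U^j R^k U... into R^(i+k) U^j U...
   increases this entry as soon as i >= 2; repeating this leads to R^a U^b.

   For [L]: by Legendre's theorem the Lagrange number is governed by the sums
   c_n + [0; c_(n+1), ...] + [0; c_(n-1), ..., c_1], and only the entries c_n = 2
   matter. Such an entry is a turn of the cyclic word w, and it is surrounded by
   runs of 2(i-1) and 2(j-1) ones, i and j being the lengths of the adjacent runs
   of letters. The fractions [0; 1, ..., 1, 2, ...] with 2(i-1) ones are separated
   for distinct i by the values [0; 1^(2m)], and increase with i. In the corner
   word some turn has adjacent runs of lengths a and b, whereas in any other word
   the runs of R and U have lengths at most a - 1 and b - 1. *)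

(** * Numerators *)

(** The row vector [r] times the matrix A or B. *)
Definition letter_act (r : nat * nat) (x : step) : nat * nat :=
  if x is Right then (2 * r.1 + r.2, r.1 + r.2) else (r.1 + r.2, r.1 + 2 * r.2).

(* Row vector of a path in terms of the state (p_i, p_(i-1)) of its continued
   fraction; x is the last letter of the path. *)
Definition letter_row (x : step) (s : nat * nat) : nat * nat :=
  if x is Right then (s.1 + s.2, s.1) else (s.1, s.1 + s.2).

Definition turn (x y : step) : seq nat := if x == y then [:: 1; 1] else [:: 2].

Lemma cf_entries_cons2 (x y : step) (w : word) :
  cf_entries (x :: y :: w) = turn x y ++ cf_entries (y :: w).
Proof. by []. Qed.

(** [letter_row] intertwines the two actions: reading [turn x y] and then forming the row for [y]
    multiplies the row for [x] by the matrix of [y]. *)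
Lemma foldl_cf_entries (x : step) (w : word) (s : nat * nat) :
  letter_row (last x w) (foldl cf_next s (cf_entries (x :: w)))
  = foldl letter_act (letter_row x s) w.
Proof.
elim: w x s => [|y w IH] x s //.
rewrite cf_entries_cons2 foldl_cat [last _ _]/= IH /=; congr foldl.
by case: x; case: y; rewrite /turn /=; congr pair; lia.
Qed.

(** The row (0, 1) and the first coordinate select the lower left entry of the product. *)
Definition letter_num (w : word) : nat := (foldl letter_act (0, 1) w).1.

Lemma path_num_letter (w : word) :
  last Right w = Up -> path_num (Right :: w) = letter_num (Right :: w).
Proof.
move=> hw; have := foldl_cf_entries Right w (1, 0).
by rewrite hw /letter_num /= => <-.
Qed.

(** The powers of A and B consist of Fibonacci numbers: f = F_(2i) and h = F_(2i-1). *)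
Lemma foldl_act_nseq (i : nat) : exists f h : nat, [/\ 0 < h, 0 < i -> 0 < f,
  forall r, foldl letter_act r (nseq i Right)
    = ((h + f) * r.1 + f * r.2, f * r.1 + h * r.2) &
  forall r, foldl letter_act r (nseq i Up)
    = (h * r.1 + f * r.2, f * r.1 + (h + f) * r.2)].
Proof.
elim: i => [|i [f [h [h0 _ ER EU]]]].
  by exists 0, 1; split=> // -[r1 r2] /=; congr pair; lia.
exists (2 * f + h), (f + h); split=> [|_|r|r]; try lia.
  by rewrite /= ER /=; congr pair; lia.
by rewrite /= EU /=; congr pair; lia.
Qed.

Lemma foldl_act_linear (w : word) : exists c d : nat,
  0 < c /\ forall r, (foldl letter_act r w).1 = c * r.1 + d * r.2.
Proof.
elim: w => [|[] w [c [d [c0 E]]]].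
- by exists 1, 0; split=> // r /=; lia.
- by exists (2 * c + d), (c + d); split=> [|r /=]; [lia|rewrite E /=; lia].
- by exists (c + d), (c + 2 * d); split=> [|r /=]; [lia|rewrite E /=; lia].
Qed.

(* By the commutator formula the difference of the two sides is a positive
   multiple of r.1 * c2 - r.2 * c1, where (c1, c2) is the first column of the
   matrix of Up :: w; the initial Up forces c1 <= c2. *)
Lemma act_swap_runs (i j : nat) (r : nat * nat) (w : word) :
  0 < i -> 0 < j -> r.2 < r.1 ->
  (foldl letter_act r (nseq j Up ++ nseq i Right ++ Up :: w)).1
  < (foldl letter_act r (nseq i Right ++ nseq j Up ++ Up :: w)).1.
Proof.
move=> i0 j0 hr; rewrite !foldl_cat.
have [f [h [h0 /(_ i0) f0 ER _]]] := foldl_act_nseq i.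
have [f' [h' [h'0 /(_ j0) f'0 _ EU]]] := foldl_act_nseq j.
have [c [d [c0 E]]] := foldl_act_linear w.
rewrite /= !E !ER !EU /=; case: r hr => r1 r2 /= hr.
(* The two sides differ by 2ff' times (r1 - r2)c + (2 r1 - r2)d, and 2 r1 - r2 is at least r1. *)
suff : 0 < 2 * (f * f') * ((r1 - r2) * c + r1 * d) by nia.
by rewrite !muln_gt0 /= f0 f'0 addn_gt0 muln_gt0 subn_gt0 hr c0.
Qed.

Lemma leading_rights (w : word) : last Right w = Up ->
  exists i v, w = nseq i Right ++ Up :: v /\ last Up v = Up.
Proof.
elim: w => //= -[] w IH hw; last by exists 0, w.
by have [i [v [-> hv]]] := IH hw; exists i.+1, v.
Qed.

Lemma nseq_cat_cons (T : Type) (n : nat) (x : T) (s : seq T) :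
  nseq n x ++ x :: s = nseq n.+1 x ++ s.
Proof. by elim: n => //= n ->. Qed.

(** Induction on the length of [w]: an initial Up joins the run of Ups, and an initial run of Rights
    is moved in front of that run by [act_swap_runs]. Two leading Rights are required because (0, 1)
    becomes (1, 1) after the first and strictly decreasing only after the second. *)
Lemma letter_num_corner_max (i j : nat) (w : word) : last Up w = Up ->
  let v := nseq i.+2 Right ++ nseq j.+1 Up ++ w in
  let c := corner_path (i.+2 + count_mem Right w) (j.+1 + count_mem Up w) in
  v = c \/ letter_num v < letter_num c.
Proof.
rewrite /corner_path.
have [n] := ubnP (size w); elim: n => // n IH in w i j *.
case: w => [|[] w] hn hw.
- by left; rewrite cats0 /= !addn0.
- right; have [k [u [E hu]]] := leading_rights w hw.
  rewrite E /= size_cat size_nseq /= in hn.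
  have EW : Right :: w = nseq k.+1 Right ++ Up :: u by rewrite E.
  have cR : count_mem Right (Right :: w) = k.+1 + count_mem Right u.
    by rewrite EW count_cat count_nseq /=; lia.
  have cU : count_mem Up (Right :: w) = (count_mem Up u).+1.
    by rewrite EW count_cat count_nseq /=; lia.
  rewrite cR cU EW.
  have lt1 : letter_num (nseq i.+2 Right ++ nseq j.+1 Up ++
                  nseq k.+1 Right ++ Up :: u)
       < letter_num (nseq i.+2 Right ++ nseq k.+1 Right ++
                  nseq j.+1 Up ++ Up :: u).
    rewrite /letter_num !(foldl_cat _ _ (nseq i.+2 _)).
    apply: act_swap_runs => //=.
    have [f [h [h0 _ ER _]]] := foldl_act_nseq i.
    by rewrite ER /=; lia.
  apply: leq_trans lt1 _.
  have EU : nseq j.+1 Up ++ Up :: u = nseq j.+2 Up ++ u.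
    exact: nseq_cat_cons.
  rewrite EU catA -nseqD.
  have hsz : size u < n by lia.
  rewrite addnA; have -> : i.+2 + k.+1 = (i + k.+1).+2 by lia.
  have -> : j.+1 + (count_mem Up u).+1 = j.+2 + count_mem Up u by lia.
  by have [<- | /ltnW] := IH u (i + k.+1) j.+1 hsz hu.
- have := IH w i j.+1 hn hw; rewrite nseq_cat_cons.
  have -> : count_mem Up (Up :: w) = (count_mem Up w).+1 by [].
  have -> : count_mem Right (Up :: w) = count_mem Right w by [].
  by rewrite addnS addSn.
Qed.

(** The vertices after one and two steps exclude a first letter U and, as [b < a], a beginning RU.
    The vertex before the endpoint excludes a last letter R. *)
Lemma below_diagonal_ends (a b : nat) (w : word) : 0 < b -> b < a ->
  paths_below_diagonal a b w ->
  exists v, w = Right :: Right :: v /\ last Right v = Up.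
Proof.
move=> b0 hab [hR hU hk].
have a0 : 0 < a by apply: leq_trans hab.
case: w hR hU hk => [|[] [|[] w]] hR hU hk.
- by rewrite -hR in a0.
- by rewrite -hU in b0.
- exists w; split=> //; move: hR hU hk; case/lastP: w => [|w x].
    by move=> _ hU; rewrite -hU in b0.
  rewrite last_rcons; case: x => // hR hU /(_ (size w).+2).
  rewrite -cats1 /= take_size_cat // => hle.
  move: hR hU; rewrite /= -!cats1 !count_cat /= => hR hU; nia.
- by have := hk 2; rewrite /= ?take0 /= ; lia.
- by have := hk 1; rewrite /= ; lia.
- by have := hk 1; rewrite /= ?take0 /= ; lia.
- by have := hk 1; rewrite /= ?take0 /= ; lia.
Qed.

Lemma corner_path_below (a b : nat) : paths_below_diagonal a b (corner_path a b).
Proof.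
rewrite /corner_path; split.
- by rewrite count_cat !count_nseq /=; lia.
- by rewrite count_cat !count_nseq /=; lia.
move=> k; rewrite take_cat size_nseq; case: ltnP => hk.
  by rewrite take_nseq ?(ltnW hk) // !count_nseq /=; lia.
rewrite !count_cat !count_nseq /= !mul0n !mul1n add0n.
have [h|h] := leqP (k - a) b.
  by rewrite take_nseq // !count_nseq /=; nia.
by rewrite take_oversize ?size_nseq ?(ltnW h) // !count_nseq /=; nia.
Qed.

Lemma path_num_corner_max (a b : nat) (w : word) : 0 < b -> b < a ->
  paths_below_diagonal a b w -> w <> corner_path a b ->
  path_num w < path_num (corner_path a b).
Proof.
move=> b0 hab hw; have [v [E hv]] := below_diagonal_ends a b w b0 hab hw.
case: hw => hR hU _; have [i [u [Ev hu]]] := leading_rights v hv.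
have Ew : w = nseq i.+2 Right ++ nseq 1 Up ++ u by rewrite E Ev.
have [] := letter_num_corner_max i 0 u hu; rewrite -Ew.
  move=> -> []; rewrite -hR -hU Ew !count_cat !count_nseq /=.
  by congr corner_path; lia.
have -> : i.+2 + count_mem Right u = a.
  by rewrite -hR Ew count_cat count_nseq /=; lia.
have -> : 1 + count_mem Up u = b.
  by rewrite -hU Ew count_cat count_nseq /=; lia.
move=> lt1 _; rewrite E path_num_letter // -E.
case: a hab {hR} lt1 => [|a] // _; rewrite /corner_path /= path_num_letter //.
case: b b0 {hU} => [|b] // _; rewrite last_cat -(addn1 b) nseqD last_cat //.
Qed.

(** * Entries of rotated and reversed words *)

Lemma cf_entries_cat (x y : step) (u v : word) :
  cf_entries ((x :: u) ++ y :: v)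
  = cf_entries (x :: u) ++ turn (last x u) y ++ cf_entries (y :: v).
Proof.
elim: u x => [|z u IH] x //.
by rewrite /= -/(_ ++ _) in IH *; rewrite IH catA.
Qed.

Lemma turnC (x y : step) : turn x y = turn y x.
Proof. by rewrite /turn eq_sym. Qed.

Lemma rev_turn (x y : step) : rev (turn x y) = turn x y.
Proof. by rewrite /turn; case: (x == y). Qed.

Lemma rev_cf_entries (w : word) : rev (cf_entries w) = cf_entries (rev w).
Proof.
elim: w => // x [|y w] IH //.
rewrite cf_entries_cons2 rev_cat IH rev_turn (rev_cons x) -cats1.
case E: (rev (y :: w)) => [|z u]; first by have := size_rev (y :: w); rewrite E.
rewrite cf_entries_cat /= cats0 turnC; congr (_ ++ turn _ _).
by have := congr1 (last x) E; rewrite rev_cons last_rcons.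
Qed.

Lemma cf_entries_1or2 (w : word) (k : nat) :
  k \in cf_entries w -> k = 1 \/ k = 2.
Proof.
elim: w => // x [|y w] IH //; rewrite cf_entries_cons2 mem_cat => /orP[|//].
by rewrite /turn; case: ifP => _; rewrite !inE ?orbb => /eqP ->; [left|right].
Qed.

(** An entry 2 comes from two distinct adjacent letters, so cutting the entries there cuts the
    word. *)
Lemma cf_entries_split (x : step) (w : word) (s1 s2 : seq nat) :
  cf_entries (x :: w) = s1 ++ 2 :: s2 ->
  exists w1 y z w2, [/\ x :: w = rcons w1 y ++ z :: w2, y != z,
    s1 = cf_entries (rcons w1 y) & s2 = cf_entries (z :: w2)].
Proof.
elim: w x s1 => [|y w IH] x s1; first by case: s1.
rewrite cf_entries_cons2 {1}/turn; have [<-|ne] := eqVneq x y.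
  case: s1 => [|? [|? s1]] //= [<- <-] E.
  have [w1 [u [v [w2 [E1 ne -> ->]]]]] := IH _ _ E.
  exists (x :: w1), u, v, w2; split=> //; first by rewrite E1.
  by case: w1 E1 => [|z w1] [<- _]; rewrite /= eqxx.
case: s1 => [|? s1] [].
  by move=> <-; exists [::], x, y, w.
move=> <- E; have [w1 [u [v [w2 [E1 ne' -> ->]]]]] := IH _ _ E.
exists (x :: w1), u, v, w2; split=> //; first by rewrite E1.
by case: w1 E1 => [|z w1] [<- _]; rewrite /= (negbTE ne).
Qed.

(** The entry 2 put in front of the period is the turn from the last letter Up back to the first
    letter Right. The period thus belongs to the cyclic word, and starting it at another 2 rotates
    the word. *)
Lemma cf_entries_rot (w : word) (m : nat) :
  last Right w = Up ->
  let s := 2 :: cf_entries (Right :: w) in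
  m < size s -> nth 0 s m = 2 ->
  exists x v, [/\ rot m s = 2 :: cf_entries (x :: v), last x v != x
    & perm_eq (x :: v) (Right :: w)].
Proof.
move=> hw s; case: m => [|m] hm hs.
  by exists Right, w; rewrite rot0 hw.
have Es : cf_entries (Right :: w) = take m (cf_entries (Right :: w))
     ++ 2 :: drop m.+1 (cf_entries (Right :: w)).
  by rewrite -[X in X :: drop _ _]hs -drop_nth // cat_take_drop.
have [w1 [y [z [w2 [Ew ne E1 E2]]]]] := cf_entries_split _ _ _ _ Es.
have hy : last Right (z :: w2) = Up.
  by have := congr1 (last Right) Ew; rewrite last_cat /= hw => ->.
have [w1' Ew1] : exists w1', rcons w1 y = Right :: w1'.
  by case: w1 Ew {E1} => [|a w1] [<- _]; eexists.
have hy' : last Right w1' = y.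
  by have := congr1 (last Right) Ew1; rewrite last_rcons.
exists z, (w2 ++ rcons w1 y); split.
- pose E := cf_entries (Right :: w); rewrite -/E in E1 E2.
  rewrite /rot -[drop m.+1 s]/(drop m E) -[take m.+1 s]/(2 :: take m E).
  have hs' : nth 0 E m = 2 by [].
  rewrite (drop_nth 0) // hs' E1 E2 Ew1 -cat_cons cf_entries_cat.
  by rewrite -[last z w2]/(last Right (z :: w2)) hy.
- by rewrite last_cat last_rcons.
- by rewrite Ew -cat_cons perm_catC.
Qed.

Lemma mem_cf_entries2 (x y : step) (v : word) : x != y ->
  2 \in cf_entries (y :: v) -> x \in v.
Proof.
move=> ne; elim: v y ne => // z v IH y ne.
rewrite cf_entries_cons2 mem_cat inE => /orP[|].
  rewrite /turn; case: eqP => // nyz _.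
  by case: x y z ne nyz {IH} => -[] [].
have [->|nz] := eqVneq z y; first by move/(IH _ ne) => ->; rewrite orbT.
by case: x y z ne nz {IH} => -[] [].
Qed.

Local Open Scope classical_set_scope.
Local Open Scope ring_scope.

(** * Convergents and Legendre's theorem *)

(* With the indices of the paper, [cnum c n] is p_(n-1) and [cden c n] is
   q_(n-1). *)
Definition cnum (c : nat -> nat) (n : nat) : nat := cf_num (mkseq c n).
Definition cden (c : nat -> nat) (n : nat) : nat := cf_den (mkseq c n).

Lemma cnumSS (c : nat -> nat) (n : nat) :
  cnum c n.+2 = (c n.+1 * cnum c n.+1 + cnum c n)%N.
Proof. by rewrite /cnum /cf_num !mkseqS -!cats1 !foldl_cat. Qed.

Lemma cdenSS (c : nat -> nat) (n : nat) :
  cden c n.+2 = (c n.+1 * cden c n.+1 + cden c n)%N.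
Proof. by rewrite /cden /cf_den !mkseqS -!cats1 !foldl_cat. Qed.

Lemma cnum0 (c : nat -> nat) : cnum c 0 = 1%N. Proof. by []. Qed.
Lemma cnum1 (c : nat -> nat) : cnum c 1 = c 0%N.
Proof. by rewrite /cnum /cf_num /=; lia. Qed.
Lemma cden0 (c : nat -> nat) : cden c 0 = 0%N. Proof. by []. Qed.
Lemma cden1 (c : nat -> nat) : cden c 1 = 1%N.
Proof. by rewrite /cden /cf_den /=; lia. Qed.

Lemma cden_gt0 (c : nat -> nat) (c0 : forall k, (0 < c k)%N) (n : nat) :
  (0 < cden c n.+1)%N.
Proof.
elim: n => [|n IH]; first by rewrite cden1.
by rewrite cdenSS addn_gt0 muln_gt0 c0 IH.
Qed.

Lemma cden_leS (c : nat -> nat) (c0 : forall k, (0 < c k)%N) (n : nat) :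
  (cden c n <= cden c n.+1)%N.
Proof.
case: n => [|n]; first by rewrite cden0.
by rewrite cdenSS (leq_trans _ (leq_addr _ _)) // leq_pmull.
Qed.

Lemma cden_ge (c : nat -> nat) (c0 : forall k, (0 < c k)%N) (n : nat) :
  (n <= cden c n.+1)%N.
Proof.
elim: n => // -[|n] IH; first exact: cden_gt0.
rewrite cdenSS; have := cden_gt0 c c0 n; have := c0 n.+2; nia.
Qed.

Lemma cnum_cden_det (K : comRingType) (c : nat -> nat) (n : nat) :
  (-1) ^+ n * ((cnum c n.+1)%:R * (cden c n)%:R
    - (cnum c n)%:R * (cden c n.+1)%:R) = -1 :> K.
Proof.
elim: n => [|n IH]; first by rewrite cnum1 cnum0 cden0 cden1; ring.
rewrite -[RHS]IH cnumSS cdenSS !natrD !natrM exprS; ring.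
Qed.

(** As a function of [m] the expression obeys the recurrence of the convergents, with values 0 at
    [n] and 1 at [n.+1]. *)
Lemma convergent_side (K : realDomainType) (c : nat -> nat)
    (c0 : forall k, (0 < c k)%N) (n m : nat) : (n <= m)%N ->
  0 <= (-1) ^+ n.+1 * ((cnum c m)%:R * (cden c n)%:R
         - (cnum c n)%:R * (cden c m)%:R) :> K.
Proof.
pose d m : K := (-1) ^+ n.+1 * ((cnum c m)%:R * (cden c n)%:R
         - (cnum c n)%:R * (cden c m)%:R).
move=> /subnK <-; rewrite -/(d _) addnC.
suff : 0 <= d (n + (m - n))%N /\ 0 <= d (n + (m - n)).+1 by case.
elim: (m - n)%N => [|k [IH1 IH2]].
  rewrite addn0; split; first by rewrite /d mulrC subrr mul0r.
  by rewrite /d exprS -mulrA cnum_cden_det mulrNN mulr1.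
rewrite addnS; split=> //.
have -> : d (n + k).+2 = (c (n + k).+1)%:R * d (n + k).+1 + d (n + k)%N.
  by rewrite /d cnumSS cdenSS !natrD !natrM; ring.
by rewrite addr_ge0 // mulr_ge0.
Qed.

(* |q_(n-1) x - p_(n-1)|, provided that the convergents alternate around x. *)
Definition cf_gap (R : realType) (c : nat -> nat) (x : R) (n : nat) : R :=
  (-1) ^+ n.+1 * ((cden c n)%:R * x - (cnum c n)%:R).

Lemma cf_gapSS (R : realType) (c : nat -> nat) (x : R) (n : nat) :
  cf_gap R c x n = (c n.+1)%:R * cf_gap R c x n.+1 + cf_gap R c x n.+2.
Proof. by rewrite /cf_gap cnumSS cdenSS !natrD !natrM !exprS; ring. Qed.

Lemma cf_gap_det (R : realType) (c : nat -> nat) (x : R) (n : nat) :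
  cf_gap R c x n * (cden c n.+1)%:R + cf_gap R c x n.+1 * (cden c n)%:R = 1.
Proof.
apply: oppr_inj; rewrite -(cnum_cden_det R c n) /cf_gap !exprS; ring.
Qed.

(** Convergents of odd index lie below those of positive even index; [x] is the supremum of the
    former. *)
Lemma cf_gap_ge0_ex (R : realType) (c : nat -> nat)
    (c0 : forall k, (0 < c k)%N) :
  exists x : R, forall n, 0 <= cf_gap R c x n.
Proof.
pose v (n : nat) : R := (cnum c n)%:R / (cden c n)%:R.
have Q0 n : 0 < (cden c n.+1)%:R :> R by rewrite ltr0n cden_gt0.
have side k n : v k.*2.+1 <= v n.+1.*2.
  rewrite /v doubleS ler_pdivrMr // mulrAC ler_pdivlMr //.
  have [h|h] := leqP k.*2.+1 n.*2.+2.
    have := convergent_side R c c0 k.*2.+1 n.*2.+2 h.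
    by rewrite -signr_odd /= odd_double /= expr0; lra.
  have := convergent_side R c c0 n.*2.+2 k.*2.+1 (ltnW h).
  by rewrite -signr_odd /= odd_double /= expr1; lra.
pose S : set R := range (fun k => v k.*2.+1).
have S0 : S !=set0 by exists (v 1%N), 0%N.
have Sub n : ubound S (v n.+1.*2) by move=> _ [k _ <-].
exists (sup S) => n; rewrite /cf_gap -signr_odd -(odd_double_half n).
case: (odd n) => /=; rewrite ?add1n ?add0n odd_double /= ?expr0 ?expr1.
  rewrite mul1r subr_ge0 mulrC -ler_pdivrMr //.
  by apply: ub_le_sup; [exists (v 2%N); apply: (Sub 0%N)|exists n./2].
(* Index 0 is the formal convergent 1/0, with gap 1. *)
case: n./2 => [|k]; first by rewrite cden0 cnum0; lra.
rewrite mulN1r opprB subr_ge0 mulrC -ler_pdivlMr ?doubleS //.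
rewrite -doubleS; exact: (ge_sup S0 (Sub k)).
Qed.

Lemma normr_convergent (R : realType) (c : nat -> nat)
    (c0 : forall k, (0 < c k)%N) (x : R) (n : nat) : 0 <= cf_gap R c x n.+1 ->
  `|(cnum c n.+1)%:R / (cden c n.+1)%:R - x|
  = cf_gap R c x n.+1 / (cden c n.+1)%:R.
Proof.
have Q0 : 0 < (cden c n.+1)%:R :> R by rewrite ltr0n cden_gt0.
have -> : (cnum c n.+1)%:R / (cden c n.+1)%:R - x =
    (-1) ^+ n.+1 * (cf_gap R c x n.+1 / (cden c n.+1)%:R).
  have ss : (-1) ^+ n * (-1) ^+ n = 1 :> R by rewrite -expr2 sqrr_sign.
  rewrite /cf_gap !exprS; move: ss; set s := (-1) ^+ n => ss.
  transitivity (- (s * s) * ((cden c n.+1)%:R * x - (cnum c n.+1)%:R)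
                / (cden c n.+1)%:R); last by field; rewrite gt_eqF.
  by rewrite ss; field; rewrite gt_eqF.
move=> h; rewrite normrM normrX normrN1 expr1n mul1r ger0_norm //.
by rewrite divr_ge0 // ltW.
Qed.

(** Both summands in [cf_gap_det] are nonnegative, so a gap is at most the reciprocal of the next
    denominator, which grows at least linearly. *)
Lemma cf_gap_ge0_value (R : realType) (c : nat -> nat)
    (c0 : forall k, (0 < c k)%N) (x : R) :
  (forall n, 0 <= cf_gap R c x n) -> cf_value R c = x.
Proof.
move=> gap0; apply: cvg_lim; first exact: Rhausdorff.
have Q0 n : 0 < (cden c n.+1)%:R :> R by rewrite ltr0n cden_gt0.
apply/subr_cvg0/norm_cvg0P.
apply: (@squeeze_cvgr _ _ _ _ (fun=> 0) harmonic).
- near=> n; rewrite normr_ge0 /= normr_convergent //.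
  have := cf_gap_det R c x n.+1.
  have hQ : 1 <= (cden c n.+1)%:R :> R by rewrite ler1n cden_gt0.
  have hQ2 : n.+1%:R <= (cden c n.+2)%:R :> R by rewrite ler_nat cden_ge.
  have g1 := gap0 n.+1; have g2 := gap0 n.+2 => det.
  apply: (@le_trans _ _ (cf_gap R c x n.+1)).
    by rewrite ler_pdivrMr // ler_peMr.
  rewrite -[leRHS]mul1r ler_pdivlMr ?ltr0n //.
  have : cf_gap R c x n.+1 * n.+1%:R <= cf_gap R c x n.+1 * (cden c n.+2)%:R.
    by rewrite ler_wpM2l.
  have : 0 <= cf_gap R c x n.+2 * (cden c n.+1)%:R by rewrite mulr_ge0.
  by lra.
- exact: cvg_cst.
- exact: cvg_harmonic.
Unshelve. all: by end_near.
Qed.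

(** If a gap vanished, the recurrence between nonnegative gaps would make the next one vanish too,
    against [cf_gap_det]. *)
Lemma cf_gap_gt0 (R : realType) (c : nat -> nat)
    (c0 : forall k, (0 < c k)%N) (n : nat) : 0 < cf_gap R c (cf_value R c) n.
Proof.
have [x gap0] := cf_gap_ge0_ex R c c0; rewrite (cf_gap_ge0_value R c c0 x gap0).
rewrite lt_neqAle gap0 andbT eq_sym; apply/eqP => E.
have := cf_gap_det R c x n; rewrite E mul0r add0r.
have -> : cf_gap R c x n.+1 = 0; last by rewrite mul0r => /esym/eqP; rewrite oner_eq0.
have g1 := gap0 n.+1; have g2 := gap0 n.+2.
have := cf_gapSS R c x n; rewrite E => /esym/eqP.
have cg : 0 <= (c n.+1)%:R * cf_gap R c x n.+1 by rewrite mulr_ge0.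
rewrite paddr_eq0 // mulf_eq0 pnatr_eq0 -leqn0 leqNgt c0 /=.
by case/andP=> /eqP.
Qed.

(* The two halves [0; c_(n+1), c_(n+2), ...] and [0; c_n, ..., c_1] of the
   doubly infinite expansion around an entry. *)
Definition cf_tail (R : realType) (c : nat -> nat) (n : nat) : R :=
  cf_gap R c (cf_value R c) n.+1 / cf_gap R c (cf_value R c) n.
Definition cf_back (R : realType) (c : nat -> nat) (n : nat) : R :=
  (cden c n)%:R / (cden c n.+1)%:R.

Lemma cf_tail_gt0 (R : realType) (c : nat -> nat)
    (c0 : forall k, (0 < c k)%N) (n : nat) : 0 < cf_tail R c n.
Proof. by rewrite divr_gt0 // cf_gap_gt0. Qed.

Lemma cf_tailE (R : realType) (c : nat -> nat)
    (c0 : forall k, (0 < c k)%N) (n : nat) :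
  cf_tail R c n = 1 / ((c n.+1)%:R + cf_tail R c n.+1).
Proof.
have g0 := cf_gap_gt0 R c c0 n; have g1 := cf_gap_gt0 R c c0 n.+1.
have := cf_gapSS R c (cf_value R c) n; rewrite /cf_tail => E.
by rewrite E; field; rewrite -E !gt_eqF.
Qed.

Lemma cf_back_ge0 (R : realType) (c : nat -> nat) (n : nat) :
  0 <= cf_back R c n.
Proof. by rewrite divr_ge0. Qed.

Lemma cf_backE (R : realType) (c : nat -> nat)
    (c0 : forall k, (0 < c k)%N) (n : nat) :
  cf_back R c n.+1 = 1 / ((c n.+1)%:R + cf_back R c n).
Proof.
have Q1 : 0 < (cden c n.+1)%:R :> R by rewrite ltr0n cden_gt0.
have Q2 : 0 < (cden c n.+2)%:R :> R by rewrite ltr0n cden_gt0.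
have E : (cden c n.+2)%:R = (c n.+1)%:R * (cden c n.+1)%:R + (cden c n)%:R :> R.
  by rewrite cdenSS natrD natrM.
by rewrite /cf_back E; field; rewrite -E !gt_eqF.
Qed.

Lemma cf_tail_le1 (R : realType) (c : nat -> nat)
    (c0 : forall k, (0 < c k)%N) (n : nat) : cf_tail R c n <= 1.
Proof.
have h1 : 1 <= (c n.+1)%:R :> R by rewrite ler1n.
have h2 := cf_tail_gt0 R c c0 n.+1.
by rewrite cf_tailE // ler_pdivrMr; lra.
Qed.

Lemma cf_back_le1 (R : realType) (c : nat -> nat)
    (c0 : forall k, (0 < c k)%N) (n : nat) : cf_back R c n <= 1.
Proof. by rewrite ler_pdivrMr ?ltr0n ?cden_gt0 // mul1r ler_nat cden_leS. Qed.

(** The constant l for which the convergent p/q just before the entry [c n.+1] has distance exactly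
    1/(l q^2) from the value. *)
Definition cf_quality (R : realType) (c : nat -> nat) (n : nat) : R :=
  (c n.+1)%:R + cf_tail R c n.+1 + cf_back R c n.

Lemma convergent_dist (R : realType) (c : nat -> nat)
    (c0 : forall k, (0 < c k)%N) (n : nat) :
  `|(cnum c n.+1)%:R / (cden c n.+1)%:R - cf_value R c|
  = 1 / (cf_quality R c n * (cden c n.+1)%:R ^+ 2).
Proof.
have Q1 : 0 < (cden c n.+1)%:R :> R by rewrite ltr0n cden_gt0.
have g0 := cf_gap_gt0 R c c0 n; have g1 := cf_gap_gt0 R c c0 n.+1.
have det := cf_gap_det R c (cf_value R c) n.
rewrite normr_convergent ?(ltW g1) //.
(* This is [cf_gap_det] divided by the product on the right, as the quotient of consecutive gaps is
   [c n.+1] plus the next tail. *)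
have -> : cf_quality R c n
    = 1 / (cf_gap R c (cf_value R c) n.+1 * (cden c n.+1)%:R).
  rewrite -[X in X / _]det /cf_quality.
  have := cf_tailE R c c0 n; have := cf_tail_gt0 R c c0 n.+1.
  have cp : 0 < (c n.+1)%:R :> R by rewrite ltr0n.
  move=> t0 /(congr1 (fun y => y^-1)); rewrite div1r invrK => <-.
  by rewrite /cf_tail /cf_back; field; rewrite !gt_eqF.
by field; rewrite !gt_eqF.
Qed.

(* Write (p, q) = u (p_n, q_n) + v (p_(n+1), q_(n+1)) with q_n <= q < q_(n+1).
   If v <> 0, then u and v have opposite signs, hence
   |q x - p| >= |q_n x - p_n|, which contradicts |v| >= 1. *)
Lemma legendre (R : realType) (c : nat -> nat)
    (c0 : forall k, (0 < c k)%N) (p q : int) : 0 < q ->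
  `|p%:~R / q%:~R - cf_value R c| < 1 / (2 * q%:~R ^+ 2) ->
  exists n, p * (cden c n.+1)%:Z = (cnum c n.+1)%:Z * q.
Proof.
move=> q0; set x := cf_value R c.
have qR : 0 < q%:~R :> R by rewrite ltr0z.
move=> hd.
have {}hd : 2 * q%:~R * `|q%:~R * x - p%:~R| < 1.
  have -> : q%:~R * x - p%:~R = - (q%:~R * (p%:~R / q%:~R - x)) :> R.
    by field; rewrite gt_eqF.
  rewrite normrN normrM (gtr0_norm qR).
  rewrite mulrA -ltr_pdivlMl ?mulr_gt0 // (lt_le_trans hd) // le_eqVlt.
  by apply/orP; left; apply/eqP; field; rewrite gt_eqF.
have [n [hn1 hn2]] : exists n, (cden c n.+1)%:Z <= q /\ q < (cden c n.+2)%:Z.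
  have ex : exists n, q < (cden c n.+1)%:Z.
    exists `|q|.+1; have := cden_ge c c0 `|q|.+1; lia.
  have := ex_minnP ex; case=> -[|n]; first by rewrite cden1; lia.
  move=> h1 h2; exists n; split=> //; rewrite leNgt; apply/negP => /h2.
  by rewrite ltnn.
exists n; apply/eqP; apply: contraT => ne.
(* The sign [s] normalizes the determinant, so that [u] and [v] are the integer coordinates of (p,
   q). *)
pose s : int := (-1) ^+ n.+1.
pose u := s * (p * (cden c n.+2)%:Z - q * (cnum c n.+2)%:Z).
pose v := s * (q * (cnum c n.+1)%:Z - p * (cden c n.+1)%:Z).
have det := cnum_cden_det int c n.+1.
have ss : s * s = 1 by rewrite -expr2 sqrr_sign.
have Eq : q = u * (cden c n.+1)%:Z + v * (cden c n.+2)%:Z.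
  transitivity (- q * (-1)); first by ring.
  by rewrite -det /u /v /s !natz; ring.
have v0 : v != 0.
  rewrite mulf_neq0 ?signr_eq0 // subr_eq0 eq_sym mulrC [q * _]mulrC //.
  by rewrite mulrC.
have := cf_gap_gt0 R c c0 n.+1; have := cf_gap_gt0 R c c0 n.+2.
rewrite -/x; set g1 := cf_gap R c x n.+1; set g2 := cf_gap R c x n.+2 => g20 g10.
have Ed : q%:~R * x - p%:~R = s%:~R * (v%:~R * g2 - u%:~R * g1) :> R.
  have -> : s%:~R = (-1) ^+ n.+1 :> R by rewrite /s rmorphXn /= rmorphN1.
  have Ep : p = u * (cnum c n.+1)%:Z + v * (cnum c n.+2)%:Z.
    transitivity (- p * (-1)); first by ring.
    by rewrite -det /u /v /s !natz; ring.
  have Eq' : q%:~R = u%:~R * (cden c n.+1)%:R + v%:~R * (cden c n.+2)%:R :> R.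
    by rewrite Eq rmorphD !rmorphM.
  have Ep' : p%:~R = u%:~R * (cnum c n.+1)%:R + v%:~R * (cnum c n.+2)%:R :> R.
    by rewrite Ep rmorphD !rmorphM.
  have tt : (-1) ^+ n * (-1) ^+ n = 1 :> R by rewrite -expr2 sqrr_sign.
  rewrite Eq' Ep' /g1 /g2 /cf_gap !exprS; move: tt; set t := (-1) ^+ n => tt.
  set d := LHS; transitivity (t * t * d); first by rewrite tt mul1r.
  by rewrite /d; ring.
have ns : `|s%:~R| = 1 :> R by rewrite /s rmorphXn /= rmorphN1 normrX normrN1 expr1n.
have hg : g1 <= `|q%:~R * x - p%:~R|.
  rewrite Ed normrM ns mul1r.
  have Q1 : 0 < (cden c n.+1)%:Z by rewrite ltz_nat cden_gt0.
  have Q2 : 0 < (cden c n.+2)%:Z by rewrite ltz_nat cden_gt0.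
  have [v1|v1] : 1 <= v \/ v <= -1 by lia.
    have u1 : u <= -1 by nia.
    have : 1 <= v%:~R :> R by rewrite ler1z.
    have : u%:~R <= -1 :> R by rewrite -[-1]/((-1)%:~R) ler_int.
    by move=> ? ?; rewrite ger0_norm; nra.
  have u1 : 1 <= u by nia.
  have : 1 <= u%:~R :> R by rewrite ler1z.
  have : v%:~R <= -1 :> R by rewrite -[-1]/((-1)%:~R) ler_int.
  by move=> ? ?; rewrite ler0_norm; nra.
(* Since q_n <= q and g1 <= |q x - p|, this identity gives |v| <= 2 q |q x - p| < 1. *)
have vE : v%:~R = s%:~R * ((cden c n.+1)%:R * (q%:~R * x - p%:~R))
     + q%:~R * g1 :> R.
  rewrite rmorphM rmorphB !rmorphM /= /g1 /cf_gap exprS.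
  have -> : (-1) ^+ n.+1 = s%:~R :> R by rewrite /s rmorphXn /= rmorphN1.
  by ring.
have : 1 <= `|v%:~R| :> R by rewrite -intr_norm ler1z; lia.
rewrite leNgt vE => /negP[]; apply: le_lt_trans hd; apply: le_trans (ler_normD _ _) _.
have hQ : (cden c n.+1)%:R <= q%:~R :> R.
  by rewrite -[(cden c n.+1)%:R]/((cden c n.+1)%:Z%:~R) ler_int.
rewrite (gtr0_norm (mulr_gt0 qR g10)) normrM ns mul1r normrM normr_nat.
have := normr_ge0 (q%:~R * x - p%:~R); nra.
Qed.

(** * Lagrange numbers from the quality of convergents *)

Definition convergent (c : nat -> nat) (n : nat) : rat :=
  (cnum c n.+1)%:Z%:Q / (cden c n.+1)%:Z%:Q.

Lemma denq_convergent (c : nat -> nat) (c0 : forall k, (0 < c k)%N) (n : nat) :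
  denq (convergent c n) = (cden c n.+1)%:Z.
Proof.
rewrite /convergent coprimeq_den; first last.
  rewrite -[coprime _ _]/(coprimez _ _); apply/coprimezP.
  have det := cnum_cden_det int c n.
  exists (- (-1) ^+ n * (cden c n)%:Z, (-1) ^+ n * (cnum c n)%:Z) => /=.
  apply: oppr_inj; transitivity (-1 : int) => //.
  by rewrite -[RHS]det !natz; ring.
by rewrite eqz_nat gtn_eqF ?cden_gt0.
Qed.

Lemma ratr_convergent (R : realType) (c : nat -> nat) (n : nat) :
  ratr (convergent c n) = (cnum c n.+1)%:R / (cden c n.+1)%:R :> R.
Proof. by rewrite /convergent fmorph_div /= !ratr_int. Qed.

Lemma cf_quality_gt0 (R : realType) (c : nat -> nat)
  (c0 : forall k, (0 < c k)%N) (n : nat) : 0 < cf_quality R c n.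
Proof.
rewrite /cf_quality; have := cf_tail_gt0 R c c0 n.+1.
have := cf_back_ge0 R c n; have : 0 < (c n.+1)%:R :> R by rewrite ltr0n.
by lra.
Qed.

Lemma approx_convergent (R : realType) (c : nat -> nat)
    (c0 : forall k, (0 < c k)%N) (l : R) (n : nat) : 0 < l ->
  (`|ratr (convergent c n) - cf_value R c|
     < 1 / (l * (denq (convergent c n))%:~R ^+ 2)) = (l < cf_quality R c n).
Proof.
move=> l0; have q0 := cf_quality_gt0 R c c0 n.
have Q0 : 0 < (cden c n.+1)%:R ^+ 2 :> R by rewrite exprn_gt0 // ltr0n cden_gt0.
rewrite denq_convergent // ratr_convergent convergent_dist // !div1r.
have -> : (cden c n.+1)%:Z%:~R = (cden c n.+1)%:R :> R by [].
rewrite ltf_pV2; first by rewrite ltr_pM2r.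
all: by rewrite posrE mulr_gt0.
Qed.

Lemma lagrange_number_ge (R : realType) (c : nat -> nat)
    (c0 : forall k, (0 < c k)%N) (l : R) : 0 < l ->
  (forall m, exists2 n, (m <= n)%N & l < cf_quality R c n) ->
  (l%:E <= lagrange_number (cf_value R c))%E.
Proof.
move=> l0 hl; apply: ereal_sup_ubound; exists l => //; split=> // /finite_seqP[s Es].
(* From this index on, convergents have denominators larger than those of all elements of [s]. *)
have [n hn lt_l] := hl (\sum_(x <- s) `|denq x|).+1%N.
have : convergent c n \in s.
  have : [set` s] (convergent c n) by rewrite -Es /= approx_convergent.
  by [].
move=> hs; have := cden_ge c c0 n; have := denq_convergent c c0 n.
rewrite (big_rem _ hs) /= in hn; lia.
Qed.

(** For a constant [k > l >= 2], Legendre's theorem makes every approximation a convergent, and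
    those from index [m] on are too far away. *)
Lemma lagrange_number_le (R : realType) (c : nat -> nat)
    (c0 : forall k, (0 < c k)%N) (l : R) (m : nat) : 2 <= l ->
  (forall n, (m <= n)%N -> cf_quality R c n <= l) ->
  (lagrange_number (cf_value R c) <= l%:E)%E.
Proof.
move=> l2 hl; apply: ge_ereal_sup => _ [k [k0 kinf] <-]; rewrite lee_fin.
rewrite leNgt; apply/negP => lk; apply: kinf.
apply: (@sub_finite_set _ _ (convergent c @` `I_m)); last first.
  by apply: finite_image; exact: finite_II.
move=> x /= hx; have qx := denq_gt0 x.
have qxR : 0 < (denq x)%:~R :> R by rewrite ltr0z.
have [n En] : exists n, numq x * (cden c n.+1)%:Z = (cnum c n.+1)%:Z * denq x.
  apply: (legendre R c c0) => //.
  have Ex : ratr x = (numq x)%:~R / (denq x)%:~R :> R by [].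
  rewrite -Ex; apply: lt_trans hx _.
  rewrite !div1r ltf_pV2 ?posrE ?mulr_gt0 ?exprn_gt0 //.
  by rewrite ltr_pM2r ?exprn_gt0 // (le_lt_trans l2).
have Ex : convergent c n = x.
  have d1 : (cden c n.+1)%:Z%:Q != 0 by rewrite intr_eq0 gt_eqF ?ltz_nat ?cden_gt0.
  have d2 : (denq x)%:Q != 0 by rewrite intr_eq0 gt_eqF.
  rewrite -[RHS]divq_num_den /convergent; apply/eqP.
  by rewrite eqr_div // -!intrM En.
move: hx; rewrite -Ex approx_convergent // => lt_k; exists n => //=.
rewrite ltnNge; apply/negP => /hl; rewrite leNgt => /negP[].
exact: lt_trans lt_k.
Qed.

(** * Lagrange numbers of paths *)

(** [foldr cf_step t s] is [0; s_1, ..., s_k + t]. *)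
Definition cf_step {R : realType} (c : nat) (t : R) : R := 1 / (c%:R + t).

(* [0; 1, 1, 1/t], so that [iter m ones_step 0] is [0; 1^(2m)] = [0; 1^(2m-2), 2]. *)
Definition ones_step {R : realType} (t : R) : R := (1 + t) / (2 + t).

Lemma foldr_cf_step_ge0 (R : realType) (s : seq nat) (t : R) :
  0 <= t -> 0 <= foldr cf_step t s.
Proof. by move=> t0; elim: s => //= c s IH; rewrite divr_ge0 // addr_ge0. Qed.

Lemma foldr_cf_step_le1 (R : realType) (s : seq nat) (t : R) :
  {in s, forall k, (0 < k)%N} -> 0 <= t <= 1 -> foldr cf_step t s <= 1.
Proof.
case: s => [_ /andP[]//|c s] hs /andP[t0 _] /=.
have c1 : 1 <= c%:R :> R by rewrite ler1n; apply: hs; rewrite inE eqxx.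
have := foldr_cf_step_ge0 R s t t0.
by move=> ?; rewrite ler_pdivrMr; lra.
Qed.

Lemma ones_step_ge0 (R : realType) (n : nat) (t : R) :
  0 <= t -> 0 <= iter n ones_step t.
Proof. by move=> t0; elim: n => //= n IH; rewrite divr_ge0 // addr_ge0. Qed.

Lemma ones_step_mono (R : realType) (n : nat) (t u : R) :
  0 <= t -> t < u -> iter n ones_step t < iter n ones_step u.
Proof.
move=> t0 tu; elim: n => //= n IH; have := ones_step_ge0 R n t t0.
move: IH; move: (iter n _ t) (iter n _ u) => x y xy x0.
have x2 : 0 < 2 + x by lra.
have y2 : 0 < 2 + y by lra.
rewrite -subr_gt0; have -> : ones_step y - ones_step x = (y - x) / ((2 + y) * (2 + x)).
  by rewrite /ones_step; field; rewrite !gt_eqF.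
by rewrite divr_gt0 ?mulr_gt0 // subr_gt0.
Qed.

Lemma ones_step_mono_le (R : realType) (n : nat) (t u : R) :
  0 <= t -> t <= u -> iter n ones_step t <= iter n ones_step u.
Proof.
move=> t0; rewrite le_eqVlt => /predU1P[->//|/(ones_step_mono R n t u t0)].
exact: ltW.
Qed.

Lemma iter_ones_step_ge (R : realType) (n : nat) :
  1 / 2 <= iter n.+1 ones_step 0 :> R.
Proof.
rewrite iterSr (_ : ones_step 0 = 1 / 2 :> R); last first.
  by rewrite /ones_step !addr0.
elim: n => //= n; move: (iter _ _ _) => x hx.
by rewrite /ones_step ler_pdivlMr; lra.
Qed.

Lemma cf_step_11 (R : realType) (t : R) : 0 <= t ->
  foldr cf_step t [:: 1; 1]%N = ones_step t.
Proof.
by move=> t0; rewrite /= /cf_step /ones_step; field; rewrite !gt_eqF; lra.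
Qed.

(** Each repeated letter of the initial run contributes one [ones_step], and the turn after the run
    a fraction at most 1/2, which is [ones_step 0]. The second turn forces another [x] behind the
    run, so the run does not contain every [x]. *)
Lemma cf_entries_turns_bound (R : realType) (x : step) (v : word) (t : R) :
  0 <= t -> (2 <= count_mem 2 (cf_entries (x :: v)))%N ->
  exists2 k, count_mem x (x :: v) = k.+2 &
    foldr cf_step t (cf_entries (x :: v)) <= iter k.+1 ones_step 0.
Proof.
move=> t0; elim: v => // y v IH.
rewrite cf_entries_cons2 count_cat foldr_cat {1 2}/turn.
have [<-|ne] := eqVneq x y.
  move=> /IH[k hk hle]; exists k.+1; first by rewrite -hk /= eqxx.
  rewrite cf_step_11 ?foldr_cf_step_ge0 //.
  by rewrite iterS; apply: (ones_step_mono_le R 1) => //; apply: foldr_cf_step_ge0.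
move=> h2; have xv : x \in v.
  apply: (mem_cf_entries2 x y v ne); rewrite -has_pred1 has_count.
  by move: h2; rewrite /=; lia.
have hc : (0 < count_mem x v)%N by rewrite -has_count has_pred1.
exists (count_mem x v).-1; first
  by rewrite /= eqxx (eq_sym y) (negbTE ne) add0n add1n prednK.
rewrite /= /cf_step; apply: le_trans (iter_ones_step_ge R _).
have := foldr_cf_step_ge0 R (cf_entries (y :: v)) t t0.
by move=> h; rewrite ler_pdivrMr; rewrite /= in h *; lra.
Qed.

(** The turn after the run contributes 1/(2 + t') with t' at most 1, hence at least 1/3. *)
Lemma foldr_corner_ge (R : realType) (x y : step) (i j : nat) (t : R) :
  x != y -> 0 <= t <= 1 ->
  iter i ones_step (1 / 3) <= foldr cf_step t
    (cf_entries (nseq i.+1 x ++ nseq j.+1 y)).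
Proof.
move=> ne ht; elim: i => [|i IH].
  have -> : nseq 1 x ++ nseq j.+1 y = x :: y :: nseq j y by [].
  rewrite cf_entries_cons2 /turn (negbTE ne) /=.
  have := foldr_cf_step_le1 R (cf_entries (y :: nseq j y)) t.
  have := foldr_cf_step_ge0 R (cf_entries (y :: nseq j y)) t.
  case/andP: (ht) => t0 t1 /(_ t0) h0 h1; have {}h1 := h1 _ ht.
  have {}h1 : foldr cf_step t (cf_entries (y :: nseq j y)) <= 1.
    by apply: h1 => k /cf_entries_1or2[] ->.
  by rewrite /cf_step ler_pdivlMr; rewrite /= in h0 h1 *; lra.
have -> : nseq i.+2 x ++ nseq j.+1 y = x :: x :: (nseq i x ++ nseq j.+1 y) by [].
rewrite cf_entries_cons2.
rewrite {1}/turn eqxx foldr_cat.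
rewrite cf_step_11 ?foldr_cf_step_ge0 //; last by case/andP: ht.
rewrite iterS; apply: (ones_step_mono_le R 1) => //.
by apply: ones_step_ge0; lra.
Qed.

(** * Windows of one period *)

Lemma cf_tail_window (R : realType) (c : nat -> nat)
    (c0 : forall k, (0 < c k)%N) (n l : nat) :
  cf_tail R c n = foldr cf_step (cf_tail R c (n + l)) (map c (iota n.+1 l)).
Proof.
elim: l n => [|l IH] n; first by rewrite addn0.
by rewrite cf_tailE // (IH n.+1) addnS.
Qed.

Lemma cf_back_window (R : realType) (c : nat -> nat)
    (c0 : forall k, (0 < c k)%N) (n l : nat) :
  cf_back R c (n + l)
  = foldr cf_step (cf_back R c n) (rev (map c (iota n.+1 l))).
Proof.
elim: l => [|l IH]; first by rewrite addn0.
rewrite addnS cf_backE // IH -[l.+1]addn1 iotaD map_cat rev_cat /=.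
by rewrite addSn.
Qed.

Lemma periodic_window (s : seq nat) (n : nat) : (0 < size s)%N ->
  [seq nth 0%N s (k %% size s) | k <- iota n (size s)] = rot (n %% size s) s.
Proof.
move=> s0; have hm : (n %% size s < size s)%N by rewrite ltn_mod.
apply: (@eq_from_nth _ 0%N); first by rewrite size_map size_iota size_rot.
rewrite size_map size_iota => i hi.
rewrite (nth_map 0%N) ?size_iota // nth_iota // -modnDml /rot nth_cat size_drop.
case: ltnP => h.
  by rewrite nth_drop modn_small //; lia.
rewrite nth_take; last by lia.
have -> : (n %% size s + i = size s + (i - (size s - n %% size s)))%N by lia.
by rewrite modnDl modn_small //; lia.
Qed.

Definition path_period (w : word) : seq nat := 2%N :: cf_entries w.

Definition path_cf (w : word) (k : nat) : nat :=
  nth 0%N (path_period w) (k %% size (path_period w)).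

Lemma path_cf_1or2 (w : word) (k : nat) : path_cf w k = 1%N \/ path_cf w k = 2%N.
Proof.
have : path_cf w k \in path_period w by rewrite mem_nth // ltn_mod.
rewrite inE => /predU1P[->|]; first by right.
exact: cf_entries_1or2.
Qed.

Lemma path_cf_gt0 (w : word) (k : nat) : (0 < path_cf w k)%N.
Proof. by case: (path_cf_1or2 w k) => ->. Qed.

(** The bound on [n] leaves a full period behind the entry. Read backwards, this period is the
    entries of [rev v] followed by the leading 2, which is absorbed into [u]. *)
Lemma cf_quality_window (R : realType) (w v : word) (n : nat) :
  (size (path_period w) <= n)%N ->
  rot (n.+1 %% size (path_period w)) (path_period w) = 2%N :: cf_entries v ->
  exists t u, [/\ 0 <= t <= 1, 0 <= u <= 1 & cf_quality R (path_cf w) n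
    = 2 + foldr cf_step t (cf_entries v) + foldr cf_step u (cf_entries (rev v))].
Proof.
set N := size _ => hn hrot; have c0 := path_cf_gt0 w.
have win k : (k %% N = n.+1 %% N)%N ->
    map (path_cf w) (iota k N) = 2%N :: cf_entries v.
  by move=> hk; rewrite -hrot -hk -periodic_window.
have EN : N = (size (cf_entries v)).+1.
  by have := congr1 size (win n.+1 erefl); rewrite size_map size_iota.
have := win n.+1 erefl; rewrite {1}EN => -[E2 Ev].
exists (cf_tail R (path_cf w) (n.+1 + size (cf_entries v))).
exists (cf_step 2 (cf_back R (path_cf w) (n - N))); split.
- by rewrite ltW ?cf_tail_gt0 ?cf_tail_le1.
- have h := cf_back_ge0 R (path_cf w) (n - N).
  by rewrite /cf_step divr_ge0 ?addr_ge0 //= ler_pdivrMr; lra.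
rewrite /cf_quality E2 (cf_tail_window R _ c0 n.+1 (size (cf_entries v))) Ev.
have -> : cf_back R (path_cf w) n = cf_back R (path_cf w) ((n - N) + N).
  by congr cf_back; lia.
rewrite (cf_back_window R _ c0) win; last first.
  by rewrite -(modnDr (n - N).+1 N); congr modn; lia.
by rewrite rev_cons foldr_rcons rev_cf_entries.
Qed.

Lemma mem2_cf_entries (x y : step) (v : word) : x != y ->
  x \in v -> 2%N \in cf_entries (y :: v).
Proof.
move=> ne; elim: v y ne => // z v IH y ne.
rewrite cf_entries_cons2 mem_cat inE /turn.
have [eyz|_] := eqVneq y z; last by rewrite inE.
by rewrite -eyz (negbTE ne) => xv; apply/orP; right; apply: IH.
Qed.

(** Apart from the corner word, a Right occurs after the first Up, which yields a turn beyond the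
    one closing the first run. *)
Lemma two_turns (w : word) : last Right w = Up ->
  let w' := Right :: w in
  w' <> corner_path (count_mem Right w') (count_mem Up w') ->
  (2 <= count_mem 2%N (cf_entries w'))%N.
Proof.
move=> hw w' ne; have [i [v [Ew hv]]] := leading_rights w hw.
have Ew' : w' = (Right :: nseq i Right) ++ Up :: v by rewrite /w' Ew.
have vR : Right \in v.
  apply: contra_notT ne => nR.
  have Ev : v = nseq (size v) Up.
    apply/all_pred1P/allP => x xv /=; case: x xv => // xv.
    by rewrite xv in nR.
  have EW : w' = nseq i.+1 Right ++ nseq (size v).+1 Up by rewrite Ew' Ev size_nseq.
  have -> : count_mem Right w' = i.+1 by rewrite EW count_cat !count_nseq /=; lia.
  by have -> : count_mem Up w' = (size v).+1 by rewrite EW count_cat !count_nseq /=; lia.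
rewrite Ew' cf_entries_cat !count_cat.
have -> : turn (last Right (nseq i Right)) Up = [:: 2%N].
  by have -> : last Right (nseq i Right) = Right by elim: (i).
have : (0 < count_mem 2%N (cf_entries (Up :: v)))%N.
  by rewrite -has_count has_pred1 (mem2_cf_entries Right).
by rewrite [count_mem 2%N [:: 2%N]]/=; lia.
Qed.

(** * Comparison with the corner word *)

Lemma path_lagrangeE (R : realType) (w : word) :
  path_lagrange R w = lagrange_number (cf_value R (path_cf w)).
Proof. by []. Qed.

Lemma rev_turns_bound (R : realType) (x : step) (v : word) (u : R) :
  0 <= u -> (2 <= count_mem 2%N (cf_entries (x :: v)))%N ->
  exists2 k, count_mem (last x v) (x :: v) = k.+2 &
    foldr cf_step u (cf_entries (rev (x :: v))) <= iter k.+1 ones_step 0.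
Proof.
rewrite -(count_rev (pred1 (last x v))) -count_rev rev_cf_entries.
by rewrite lastI rev_rcons; apply: cf_entries_turns_bound.
Qed.

(** An entry 1 has quality at most 3, which the bound reaches because both iterates are at least
    1/2. Around an entry 2 the two runs consist of different letters, so one side is bounded through
    the Rights and the other through the Ups. *)
Lemma path_lagrange_le (R : realType) (w : word) : last Right w = Up ->
  let w' := Right :: w in
  (2 <= count_mem 2%N (cf_entries w'))%N ->
  (path_lagrange R w' <= (2 + iter (count_mem Right w').-1 ones_step 0
     + iter (count_mem Up w').-1 ones_step 0)%:E)%E.
Proof.
move=> hw w' h2; rewrite path_lagrangeE.
have [k hk _] := cf_entries_turns_bound R Right w 0 (lexx _) h2.
have [k' hk' _] := rev_turns_bound R Right w 0 (lexx _) h2.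
rewrite hw in hk'; have h1 := iter_ones_step_ge R k; have h1' := iter_ones_step_ge R k'.
apply: (lagrange_number_le R _ (path_cf_gt0 w') _ (size (path_period w'))).
  by rewrite /w' hk hk' -!pred_Sn; lra.
move=> n hn; have [c1|c2] := path_cf_1or2 w' n.+1.
  have := cf_back_le1 R _ (path_cf_gt0 w') n.
  have := cf_tail_le1 R _ (path_cf_gt0 w') n.+1.
  by rewrite /cf_quality c1 /w' hk hk' -!pred_Sn; lra.
have [x [v [hrot ne hperm]]] :=
  cf_entries_rot w (n.+1 %% size (path_period w')) hw
    (ltn_pmod n.+1 (ltn0Sn (size (cf_entries w')))) c2.
have [t [u [/andP[t0 t1] /andP[u0 u1] ->]]] := cf_quality_window R w' _ n hn hrot.
have hE : count_mem 2%N (cf_entries (x :: v)) = count_mem 2%N (cf_entries w').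
  have /permPl/permP/(_ (pred1 2%N)) :=
    perm_rot (n.+1 %% size (path_period w')) (path_period w').
  by rewrite hrot => -[].
rewrite -hE in h2.
have [j hj le_j] := cf_entries_turns_bound R x v t t0 h2.
have [j' hj' le_j'] := rev_turns_bound R x v u u0 h2.
have perm := permP hperm.
rewrite (perm (pred1 x)) in hj; rewrite (perm (pred1 (last x v))) in hj'.
case: x hj ne le_j le_j' {hrot hperm hE h2 perm} hj' => hj;
 case: (last _ v) => // _ le_j le_j' hj'.
  by rewrite /w' hj hj' -!pred_Sn; lra.
by rewrite /w' hj hj' -!pred_Sn; lra.
Qed.

(** At the entry 2 closing the cyclic word, the run of Rights lies ahead and the run of Ups behind.
    The value 1/4, strictly between 0 and 1/3, leaves room both above the stated bound and below the
    qualities. *)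
Lemma path_lagrange_corner (R : realType) (i j : nat) :
  ((2 + iter i ones_step 0 + iter j ones_step 0)%:E
   < path_lagrange R (corner_path i.+1 j.+1))%E.
Proof.
set w := corner_path _ _; rewrite path_lagrangeE.
have lt4 n : iter n ones_step 0 < iter n ones_step (1 / 4) :> R.
  by apply: ones_step_mono; lra.
have lt3 n : iter n ones_step (1 / 4) < iter n ones_step (1 / 3) :> R.
  by apply: ones_step_mono; lra.
have ge0 n : 0 <= iter n ones_step 0 :> R by apply: ones_step_ge0.
apply: (@lt_le_trans _ _ (2 + iter i ones_step (1 / 4) + iter j ones_step (1 / 4))%:E).
  by rewrite lte_fin; have := lt4 i; have := lt4 j; lra.
apply: (lagrange_number_ge R _ (path_cf_gt0 w)).
  by have := lt4 i; have := lt4 j; have := ge0 i; have := ge0 j; lra.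
move=> m; pose N := size (path_period w).
have N0 : (0 < N)%N by [].
(* The quality at [n] concerns the entry [n.+1], here a multiple of the period; [m.+2] also leaves a
   full period behind it. *)
exists (m.+2 * N).-1; first by nia.
have hn : (N <= (m.+2 * N).-1)%N by nia.
have hS : (m.+2 * N).-1.+1 = (m.+2 * N)%N by nia.
have hrot : rot ((m.+2 * N).-1.+1 %% N) (path_period w) = 2%N :: cf_entries w.
  by rewrite hS modnMl rot0.
have [t [u [ht hu ->]]] := cf_quality_window R w w _ hn hrot.
have h1 := foldr_corner_ge R Right Up i j t isT ht.
have := foldr_corner_ge R Up Right j i u isT hu.
have -> : rev w = nseq j.+1 Up ++ nseq i.+1 Right.
  by rewrite /w /corner_path rev_cat !rev_nseq.
rewrite -/(corner_path i.+1 j.+1) -/w in h1.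
by move=> h2; have := lt3 i; have := lt3 j; lra.
Qed.

Theorem theorem1p5 (R : realType) (a b : nat)
    (hb : (0 < b)%N) (hab : (b < a)%N) (hcop : coprime a b) :
  paths_below_diagonal a b (corner_path a b) /\
  (forall w : word, paths_below_diagonal a b w -> w <> corner_path a b ->
     (path_num w < path_num (corner_path a b))%N /\
     (path_lagrange R w < path_lagrange R (corner_path a b))%E).
Proof.
split=> [|w hw ne]; first exact: corner_path_below.
split; first exact: path_num_corner_max.
have [v [Ew hv]] := below_diagonal_ends a b w hb hab hw.
have [hR hU _] := hw.
have h2 : (2 <= count_mem 2%N (cf_entries (Right :: Right :: v)))%N.
  by apply: two_turns => //; rewrite -Ew hR hU.
have := path_lagrange_le R (Right :: v) hv h2; rewrite -Ew hR hU.
move=> /le_lt_trans; apply.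
(* At these indices the strict lower bound for the corner word coincides with the upper bound for
   [w]. *)
have := path_lagrange_corner R a.-1 b.-1.
by rewrite !prednK //; lia.
Qed.
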